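(* $E_1\ \le_B\ \underline{\bowtie}^{<\omega}_{\mathsf{CO}}$.
   Context: $E_1$ is the equivalence relation on $\mathbb{R}^{\mathbb{N}}$ with $(x_n)E_1(y_n)$ iff there is $m$ such that $x_n=y_n$ for all $n\ge m$. A circular order on $X$ is a ternary relation $C$ satisfying cyclicity, antisymmetry/reflexivity ($C(x,y,z)\wedge C(y,x,z)\iff x=y\vee y=z\vee z=x$), transitivity ($C(x,y,z)\Rightarrow\forall t\,(C(x,y,t)\vee C(t,y,z))$) and totality ($C(x,y,z)\vee C(y,x,z)$). Embeddings are injections preserving $C$. $A$ is convex in $C$ if for distinct $x,y\in A$, either all $c$ with $C(x,c,y)$ or all $c$ with $C(y,c,x)$ lie in $A$. A finite convex partition $\{C_i:i<n\}$ of $C$ is a partition into convex sets such that $C(x,y,z)$, $x\in C_i,y\in C_j,z\in C_k$ imply $(i,j,k)$ is cyclically ordered in $\{0,\dots,n-1\}$. $C\trianglelefteq^{<\omega}_c C'$ iff there are a finite convex partition $\{C_i\}$ of $C$ and an embedding $f\colon C\to C'$ with each $f(C_i)$ convex in $C'$. $\mathsf{CO}$ is the Polish space of codes for circular orders on $\mathbb{N}$ and $C\mathrel{\underline{\bowtie}^{<\omega}_{\mathsf{CO}}}C'$ iff $C\trianglelefteq^{<\omega}_c C'$ and $C'\trianglelefteq^{<\omega}_c C$. $\le_B$ is Borel reducibility. *)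

(* Defs.v *)
From mathcomp Require Import all_boot all_algebra.
From mathcomp Require Import all_classical all_reals all_analysis.
Import numFieldNormedType.Exports.

Set Implicit Arguments.
Unset Strict Implicit.
Unset Printing Implicit Defensive.

Local Open Scope classical_set_scope.

Definition borel (T : topologicalType) : set (set T) := <<s open >>.

Definition borel_function (T U : topologicalType) (f : T -> U) : Prop :=
  forall B : set U, borel B -> borel (f @^-1` B).

Definition borel_reducible (T U : topologicalType)
    (E : T -> T -> Prop) (F : U -> U -> Prop) : Prop :=
  exists2 f : T -> U, borel_function f & forall x y, E x y <-> F (f x) (f y).

Definition real_sequences (R : realType) : topologicalType := {ptws nat -> R}.

Definition E1 (R : realType) (x y : real_sequences R) : Prop :=
  exists m, forall n, (m <= n)%N -> x n = y n.

Record circular_order (X : Type) (C : X -> X -> X -> Prop) : Prop := {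
  co_cyclic : forall x y z, C x y z -> C y z x;
  co_antisym_refl : forall x y z,
    (C x y z /\ C y x z) <-> [\/ x = y, y = z | z = x];
  co_trans : forall x y z, C x y z -> forall t, C x y t \/ C t y z;
  co_total : forall x y z, C x y z \/ C y x z }.

Definition co_embedding (X Y : Type) (C : X -> X -> X -> Prop)
    (D : Y -> Y -> Y -> Prop) (f : X -> Y) : Prop :=
  injective f /\ forall x y z, C x y z -> D (f x) (f y) (f z).

Definition co_convex (X : Type) (C : X -> X -> X -> Prop) (A : set X) : Prop :=
  forall x y, A x -> A y -> x <> y ->
    (forall c, C x c y -> A c) \/ (forall c, C y c x -> A c).

(* The reflexive circular order induced by the usual order of nat; triples
   with a repetition are always related. *)
Definition cyclically_ordered (i j k : nat) : Prop :=
  [\/ i <= j <= k, j <= k <= i | k <= i <= j]%N.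

Record finite_convex_partition (X : Type) (C : X -> X -> X -> Prop) (n : nat)
    (P : 'I_n -> set X) : Prop := {
  fcp_nonempty : forall i, P i !=set0;
  fcp_disjoint : trivIset setT P;
  fcp_cover : \bigcup_i P i = setT;
  fcp_convex : forall i, co_convex C (P i);
  fcp_cyclic : forall x y z i j k, C x y z -> P i x -> P j y -> P k z ->
    cyclically_ordered i j k }.

Definition piecewise_convex_embeddable (X Y : Type)
    (C : X -> X -> X -> Prop) (D : Y -> Y -> Y -> Prop) : Prop :=
  exists (n : nat) (P : 'I_n -> set X) (f : X -> Y),
    [/\ finite_convex_partition C P, co_embedding C D f &
        forall i, co_convex D (f @` P i)].

Definition coded_relation (c : {ptws nat * nat * nat -> bool})
    (x y z : nat) : Prop := c (x, y, z).

(* As a type, CO carries the subspace topology of the product topology. *)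
Definition CO : set {ptws nat * nat * nat -> bool} :=
  [set c | circular_order (coded_relation c)].

Definition CO_piecewise_biembeddable (c d : CO) : Prop :=
  piecewise_convex_embeddable
    (coded_relation (set_val c)) (coded_relation (set_val d)) /\
  piecewise_convex_embeddable
    (coded_relation (set_val d)) (coded_relation (set_val c)).

(* Main.v *)
(* Fix the linear order K obtained from the rationals by replacing q with a
   finite chunk whose size codes the pair (n, q).  Send x to the circular order
   closing up the sum over n of the blocks
     K restricted to [x_n, +oo[  +  K restricted to ]-oo, x_n[  +  K * omega.
   Both restrictions of K embed into copies of K, hence every block splits into
   three convex pieces that embed into the K * omega part of the block of any
   other real; so changing finitely many x_n costs finitely many pieces.
   Conversely, finitely many convex pieces leave a tail of blocks inside one
   piece, on which the embedding maps chunks onto chunks of the same size and so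
   preserves the labels (n, q).  If x_n <= q < y_n and q' < x_n, then the first
   chunk q in the block of x is preceded in its block by no chunk q', whereas
   every chunk q in the block of y is. *)
Require Import Defs.
From mathcomp Require Import all_boot all_algebra.
From mathcomp Require Import all_classical all_reals all_analysis.
From mathcomp Require Import all_order zify.
Import Order.TTheory GRing.Theory Num.Theory.
Import numFieldNormedType.Exports.

Set Implicit Arguments.
Unset Strict Implicit.
Unset Printing Implicit Defensive.

Local Open Scope classical_set_scope.

(** * Circular orders obtained by closing up linear orders *)

Section CircularOrderOfTotalOrder.
Context {d : Order.disp_t} {L : orderType d}.
Local Open Scope order_scope.

Definition circ (a b c : L) : bool :=
  [|| a <= b <= c, b <= c <= a | c <= a <= b].

(* Replacing finitely many elements by their ranks turns any statement about
   their order into linear arithmetic over nat. *)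
Lemma nat_rank (s : seq L) :
  exists r : L -> nat,
    {in s &, forall a b, (a <= b) = (r a <= r b)%N /\ (a = b <-> r a = r b)}.
Proof.
pose r := fun a => count (< a) s.
have leE : {in s &, forall a b, (a <= b) = (r a <= r b)%N}.
  move=> a b sa sb; case: (leP a b) => [ab|ba].
    by apply/esym/sub_count => c /= ca; exact: lt_le_trans ab.
  (* If b < a, every entry of s that is at most b counts towards [r a], and b itself is not counted
     in [r b]. *)
  have := count_predUI (< b) (pred1 b) s.
  have : (count (predU (< b) (pred1 b)) s <= r a)%N.
    by apply/sub_count => c /= /orP[cb|/eqP->//]; exact: lt_trans ba.
  have : (0 < count (pred1 b) s)%N by rewrite -has_count has_pred1.
  have -> : count (predI (< b) (pred1 b)) s = 0%N.
    apply/eqP; rewrite -leqn0 leqNgt -has_count; apply/hasPn => c _ /=.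
    by case: eqVneq => [->|]; rewrite ?ltxx ?andbF.
  rewrite addn0 -[count (< b) s]/(r b) => pos le_ra eq_sum.
  apply/esym/negbTE; rewrite -ltnNge; apply: leq_trans le_ra.
  by rewrite eq_sum -addn1 leq_add2l.
exists r => a b sa sb; rewrite leE //; split=> //; split=> [-> //|rab].
by apply: le_anti; rewrite !leE // rab !leqnn.
Qed.

Lemma circ_circular_order (X : Type) (k : X -> L) : injective k ->
  circular_order (fun x y z => circ (k x) (k y) (k z)).
Proof.
rewrite /circ => k_inj; split.
- move=> x y z; have [r rE] := nat_rank [:: k x; k y; k z].
  by rewrite !(rE _ _ _ _).1 ?inE ?eqxx ?orbT //; lia.
- move=> x y z; have [r rE] := nat_rank [:: k x; k y; k z].
  have inj a b : a \in [:: k x; k y; k z] -> b \in [:: k x; k y; k z] ->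
    r a = r b -> a = b by move=> sa sb; exact: (rE _ _ sa sb).2.2.
  split; last first.
    by case=> ->; rewrite !(rE _ _ _ _).1 ?inE ?eqxx ?orbT //; lia.
  rewrite !(rE _ _ _ _).1 ?inE ?eqxx ?orbT // => -[h1 h2].
  have : [\/ r (k x) = r (k y), r (k y) = r (k z) | r (k z) = r (k x)].
    have /or3P[/eqP ?|/eqP ?|/eqP ?] : [|| r (k x) == r (k y),
      r (k y) == r (k z) | r (k z) == r (k x)] by lia.
    - exact: Or31.
    - exact: Or32.
    - exact: Or33.
  by case=> ?; [apply: Or31|apply: Or32|apply: Or33]; apply/k_inj/inj;
     rewrite ?inE ?eqxx ?orbT.
- move=> x y z + t; have [r rE] := nat_rank [:: k x; k y; k z; k t].
  by rewrite !(rE _ _ _ _).1 ?inE ?eqxx ?orbT //; lia.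
- move=> x y z; have [r rE] := nat_rank [:: k x; k y; k z].
  by rewrite !(rE _ _ _ _).1 ?inE ?eqxx ?orbT //; lia.
Qed.

(** Going round the circle one meets x, y, x', y' in this order, so the arc from x to y is part of
    the arc that runs from y' round to x'. *)
Lemma circ_arc (x y x' y' z : L) :
  circ x y x' -> circ x y y' -> circ x x' y' -> circ x z y ->
  x <> y -> x <> x' -> x <> y' -> z <> x -> z <> y -> circ y' z x'.
Proof.
rewrite /circ; have [r rE] := nat_rank [:: x; y; x'; y'; z].
do 5!rewrite (propext (rE _ _ _ _).2) ?inE ?eqxx ?orbT //.
by rewrite !(rE _ _ _ _).1 ?inE ?eqxx ?orbT //; lia.
Qed.

End CircularOrderOfTotalOrder.

(** * The coloured linear orders *)

(** The successor makes every chunk nonempty, so each chunk has a first point. *)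
Definition chunk_size (n : nat) (q : rat) : nat := (pickle (n, q)).+1.

Lemma chunk_size_inj n q n' q' :
  chunk_size n q = chunk_size n' q' -> n = n' /\ q = q'.
Proof. by case=> /(pcan_inj (@pickleK (nat * rat)%type)) [-> ->]. Qed.

(* A quadruple (n, (t, (q, j))) is the j-th point of the chunk of q in the t-th
   copy of the n-th block; copy 0 is the one that gets cut at x_n. *)
Definition raw : Type := nat * (nat * (rat * nat)).

Definition raw_points : set raw := 
  [set p : raw | (p.2.2.2 < chunk_size p.1 p.2.2.1)%N].

(** One enumeration serves every x: the set of points is fixed, and x enters only through the keys
    that order it. *)
Lemma raw_points_enum :
  exists e : nat -> raw, injective e /\ range e = raw_points.
Proof.
have inf : infinite_set raw_points.
  pose f i : raw := (i, (0, (0%R, 0)))%N.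
  have f_inj : {in [set: nat] &, injective f} by move=> i j _ _ [].
  apply: (@sub_infinite_set _ [set f i | i in [set: nat]]).
    by move=> _ [i _ <-].
  apply/infiniteP; have := inj_card_eq f_inj.
  by rewrite card_eq_le => /andP[].
have /card_set_bijP[f [fI f_inj f_surj]] :=
  eq_card_nat (countableP raw_points) inf.
have /choice[e eP] i : exists p, raw_points p /\ f p = i.
  by have [p Ap fp] := f_surj i I; exists p.
exists e; split=> [i j eij|].
  by rewrite -(eP i).2 -(eP j).2 eij.
apply/seteqP; split=> [_ [i _ <-]|p Ap]; first exact: (eP i).1.
exists (f p) => //; apply: f_inj; rewrite ?inE //; first exact: (eP _).1.
exact: (eP _).2.
Qed.

Definition raw_point : nat -> raw := sval (cid raw_points_enum).

Lemma raw_point_inj : injective raw_point.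
Proof. exact: (svalP (cid raw_points_enum)).1. Qed.

Lemma range_raw_point : range raw_point = raw_points.
Proof. exact: (svalP (cid raw_points_enum)).2. Qed.

Definition key : Type := nat *l (nat *l (rat *l nat)).

Definition mk_key (n k : nat) (q : rat) (j : nat) : key := (n, (k, (q, j))).

Lemma key_ltE (n k : nat) (q : rat) (j n' k' : nat) (q' : rat) (j' : nat) :
  (mk_key n k q j < mk_key n' k' q' j')%O =
  (n < n')%N || (n == n') && ((k < k')%N || (k == k') &&
    ((q < q')%R || (q == q') && (j < j')%N)).
Proof.
rewrite /mk_key !ltxi_pair !leEnat ltEnat /=.
case: (ltngtP n n') => //= _; case: (ltngtP k k') => //= _.
by case: (ltgtP q q').
Qed.

Lemma key_leW (n k : nat) (q : rat) (j n' k' : nat) (q' : rat) (j' : nat) :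
  (mk_key n k q j <= mk_key n' k' q' j')%O ->
  (n <= n')%N /\
  (n = n' -> (k <= k')%N /\ (k = k' -> (q <= q')%R)).
Proof.
rewrite /mk_key !lexi_pair !leEnat => /andP[nn' h]; split=> // en.
move: h; rewrite en leqnn /= => /andP[kk' h]; split=> // ek.
by move: h; rewrite ek leqnn /= => /andP[].
Qed.

(** The two existence clauses make parts 0 and 1 of every block nonempty. *)
Definition is_cut (P : rat -> bool) : Prop :=
  [/\ forall p q, (p <= q)%R -> P q -> P p, exists q, P q & exists q, ~~ P q].

Section Coloured.
Variable S : nat -> rat -> bool.

(* Splits copy 0 into the parts 0 (above the cut) and 1 (below it), shifting
   the later copies by one; S n plays the role of {q | q < x_n}. *)
Definition copy_index (n t : nat) (q : rat) : nat :=
  if t is t'.+1 then t.+1 else S n q.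

(** This is the range of [point_key]: part 0 keeps the rationals outside the cut, part 1 those
    inside, and later parts are full copies of K. *)
Definition is_key (n k : nat) (q : rat) (j : nat) : bool :=
  [&& (j < chunk_size n q)%N, (k == 0%N) ==> ~~ S n q & (k == 1%N) ==> S n q].

Definition point_key (i : nat) : key :=
  let: (n, (t, (q, j))) := raw_point i in mk_key n (copy_index n t q) q j.

Lemma point_key_inj : injective point_key.
Proof.
move=> i i'; rewrite /point_key => ii'; apply: raw_point_inj; move: ii'.
case: (raw_point i) => [n [t [q j]]]; case: (raw_point i') => [n' [t' [q' j']]].
rewrite /mk_key /copy_index => -[en + eq ej]; rewrite -en -eq -ej.
by case: t t' => [|t] [|t']; case: (S n q) => //= -[->].
Qed.

Lemma point_keyP (i : nat) :
  exists n k q j, is_key n k q j /\ point_key i = mk_key n k q j.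
Proof.
have : raw_points (raw_point i) by rewrite -range_raw_point; exists i.
rewrite /raw_points /point_key /=.
case: (raw_point i) => [n [t [q j]]] /= jS.
exists n, (copy_index n t q), q, j; split=> //.
by rewrite /is_key jS /copy_index; case: t; case: (S n q).
Qed.

Lemma is_keyP (n k : nat) (q : rat) (j : nat) :
  is_key n k q j -> exists i, point_key i = mk_key n k q j.
Proof.
move=> /and3P[jS k0 k1].
(* Parts 0 and 1 both come from copy 0 and part k > 1 from copy k - 1, so the truncated predecessor
   recovers the copy. *)
have : range raw_point (n, (k.-1, (q, j))) by rewrite range_raw_point.
move=> [i _ iE]; exists i; rewrite /point_key iE /copy_index.
by case: k k0 k1 {iE} => [|[|k]] //= => [/negbTE|_] ->.
Qed.

Lemma point_key_succ (a b : nat) (n k : nat) (q : rat) (j : nat) :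
  point_key a = mk_key n k q j -> point_key b = mk_key n k q j.+1 ->
  forall c, (point_key a <= point_key c <= point_key b)%O -> c = a \/ c = b.
Proof.
move=> aE bE c; have [n' [k' [q' [j' [_ cE]]]]] := point_keyP c.
move=> /andP[]; rewrite !le_eqVlt => /predU1P[/point_key_inj->|]; first by left.
move=> + /predU1P[/point_key_inj->|]; first by right.
rewrite aE bE cE !key_ltE.
case: (ltngtP n n') => //= _; case: (ltngtP k k') => //= _.
by case: (ltgtP q q') => //= _; lia.
Qed.

Hypothesis S_cut : forall n, is_cut (S n).

(** Immediate successors occur only inside a chunk. Look at the first coordinate where the keys
    differ: in a later block, part k + 2 gives a point between; in a later part, part 0 is unbounded
    above or the full part of b is unbounded below; distinct rationals have a midpoint; within one
    chunk there is the next position. *)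
Lemma point_key_dense (a b : nat) (n k : nat) (q : rat) (j : nat) :
  (point_key a < point_key b)%O -> point_key a = mk_key n k q j ->
  point_key b = mk_key n k q j.+1 \/
  exists c, (point_key a < point_key c < point_key b)%O.
Proof.
have [n1 [k1 [q1 [j1 [+ aE]]]]] := point_keyP a.
have [n2 [k2 [q2 [j2 [/and3P[j2S k20 k21] bE]]]]] := point_keyP b.
rewrite {}aE {}bE => /and3P[j1S k10 k11] + [en ek eq ej].
rewrite {}en {}ek {}eq {}ej in j1S k10 k11 *.
have mid n3 k3 q3 j3 : is_key n3 k3 q3 j3 ->
    (mk_key n k q j < mk_key n3 k3 q3 j3 < mk_key n2 k2 q2 j2)%O ->
    exists c, (mk_key n k q j < point_key c < mk_key n2 k2 q2 j2)%O.
  by move=> /is_keyP[c <-]; exists c.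
rewrite key_ltE => n2P; move: n2P mid j2S k20 k21.
move=> /orP[nn2|/andP[/eqP<- /orP[kk2|/andP[/eqP<-
  /orP[qq2|/andP[/eqP<- jj2]]]]]] mid j2S k20 k21.
- right; apply: (mid n k.+2 q 0%N) => //.
  by rewrite !key_ltE nn2 eqxx ltnS leqnSn orbT.
- right; case: k2 kk2 k20 k21 mid => [//|[|k2]] kk2 _ k21 mid.
    have k0 : k = 0%N by lia.
    rewrite k0 in mid k10 *; apply: (mid n 0%N (q + 1)%R 0%N).
      rewrite /is_key /= andbT; apply/negP => Sq1; have [down _ _] := S_cut n.
      by move: k10; rewrite (down _ _ _ Sq1) // lerDl.
    by rewrite !key_ltE !eqxx ltrDl ltr01 !orbT.
  apply: (mid n k2.+2 (q2 - 1)%R 0%N) => //.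
  by rewrite !key_ltE !eqxx kk2 ltrBlDr ltrDl ltr01 /= !orbT.
- right; pose m := ((q + q2) / 2)%R; apply: (mid n k m 0%N).
    have [down _ _] := S_cut n.
    rewrite /is_key /=; apply/andP; split; apply/implyP => /eqP ek0.
      apply: contra (implyP k10 _); last by rewrite ek0.
      by apply: down; exact: (midf_le (ltW qq2)).1.
    by apply: down (implyP k21 _); [exact: (midf_le (ltW qq2)).2|rewrite ek0].
  by rewrite !key_ltE !eqxx !ltnn /= (midf_lt qq2).1 (midf_lt qq2).2.
- case: (ltngtP j.+1 j2) jj2 => // [jj2 _|<- _]; last by left.
  right; apply: (mid n k q j.+1); last first.
    by rewrite !key_ltE !eqxx ltnSn jj2 !orbT.
  by rewrite /is_key k10 k11 (ltn_trans jj2).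
Qed.

End Coloured.

(** * Convex sets and convex partitions from intervals *)

Section LinearEnumeration.
Context {d : Order.disp_t} {L : orderType d} {X : Type} (k : X -> L).
Hypothesis k_inj : injective k.
Local Open Scope order_scope.

Let C x y z : Prop := circ (k x) (k y) (k z).

Lemma circ_between (a b c : L) : a < b -> circ a c b -> a <= c <= b.
Proof. by move=> ab /or3P[//|/andP[_]|/andP[+ _]]; rewrite leNgt ab. Qed.

Lemma between_circ (a b c : L) : a <= b <= c -> circ a b c.
Proof. by move=> abc; apply/orP; left. Qed.

Lemma interval_co_convex (A : set X) :
  (forall x y z, A x -> A y -> k x <= k z <= k y -> A z) -> co_convex C A.
Proof.
move=> A_itv x y Ax Ay xy.
have [lt_xy|lt_yx|/k_inj//] := ltgtP (k x) (k y); [left|right] => c Cc.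
- exact: A_itv Ax Ay (circ_between lt_xy Cc).
- exact: A_itv Ay Ax (circ_between lt_yx Cc).
Qed.

(** Fibres of a monotone map are intervals, and the map carries each of the three linear patterns of
    [circ] to the same pattern of indices. *)
Lemma monotone_convex_partition (n : nat) (p : X -> 'I_n) :
  (forall x y, k x <= k y -> (p x <= p y)%N) -> (forall i, exists x, p x = i) ->
  finite_convex_partition C (fun i => [set x | p x = i]).
Proof.
move=> p_mono p_surj; split=> //.
- by apply/trivIsetP => i j _ _ ij; apply/seteqP; split=> // x [/= pi pj];
     move: ij; rewrite -pi -pj eqxx.
- by apply/seteqP; split=> // x _; exists (p x).
- move=> i; apply: interval_co_convex => x y z /= xi yi /andP[xz zy].
  apply/val_inj/anti_leq; apply/andP; split.
    by rewrite -yi; exact: p_mono.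
  by rewrite -xi; exact: p_mono.
- move=> x y z _ _ _ /or3P[] /andP[h1 h2] <- <- <-;
    [apply: Or31|apply: Or32|apply: Or33]; by rewrite !p_mono.
Qed.

End LinearEnumeration.

Definition cut_order (S : nat -> rat -> bool) (a b c : nat) : Prop :=
  circ (point_key S a) (point_key S b) (point_key S c).

(** * Eventually equal sequences *)

Section EventuallyEqual.
Variables (S T : nat -> rat -> bool) (m : nat).
Hypothesis S_cut : forall n, is_cut (S n).
Hypothesis eq_tail : forall n, (m <= n)%N -> S n =1 T n.

(* Parts 0 and 1 of the old cut copy become part of the uncut copies 2 and 3. *)
Let shift (u : key) : key := let: (n, (k, (q, j))) := u in
  mk_key n (if (n < m)%N then k.+2 else k) q j.

(** A block n < m has three pieces: part 0, part 1, and all its uncut copies together. The tail from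
    block m on is the single last piece. *)
Let piece (u : key) : nat :=
  let: (n, (k, _)) := u in if (n < m)%N then (n * 3 + minn k 2)%N else (m * 3)%N.

Let shift_lt (u v : key) : (shift u < shift v)%O = (u < v)%O.
Proof.
case: u v => [n [k [q j]]] [n' [k' [q' j']]].
rewrite [RHS]key_ltE /shift key_ltE.
have [->|] // := eqVneq n n'.
by case: ifP => _; rewrite ?ltnS ?eqSS.
Qed.

Let piece_mono (u v : key) : (u <= v)%O -> (piece u <= piece v)%N.
Proof.
rewrite le_eqVlt => /predU1P[->//|].
case: u v => [n [k [q j]]] [n' [k' [q' j']]]; rewrite key_ltE /piece => uv.
have : (n < n')%N \/ n = n' /\ (k <= k')%N.
  case/orP: uv => [|/andP[/eqP<-] /orP[|/andP[/eqP<- _]]]; [by left| |];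
    by right; rewrite ?leqnn //; split=> //; exact: ltnW.
by case: ifP; case: ifP; lia.
Qed.

Let piece_lt (u : key) : (piece u < (m * 3).+1)%N.
Proof. by case: u => [n [k [q j]]]; rewrite /piece; case: ifP; lia. Qed.

(** Before block m the target part is at least 2, hence full; from block m on the two cuts agree. *)
Let shift_exists (a : nat) :
  exists b, point_key T b = shift (point_key S a).
Proof.
have [n [k [q [j [/and3P[jS k0 k1] ->]]]]] := point_keyP S a.
apply: is_keyP; rewrite /is_key jS; case: ltnP => //= mn.
by rewrite -eq_tail // k0 k1.
Qed.

Lemma eventually_eq_embeddable :
  piecewise_convex_embeddable (cut_order S) (cut_order T).
Proof.
have [f fE] := choice shift_exists.
pose p (a : nat) : 'I_(m * 3).+1 := Ordinal (piece_lt (point_key S a)).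
have f_le a b :
    (point_key T (f a) <= point_key T (f b))%O =
    (point_key S a <= point_key S b)%O.
  by rewrite !leNgt !fE shift_lt.
exists (m * 3).+1, (fun i => [set a | p a = i]), f; split.
- apply: monotone_convex_partition; first exact: point_key_inj.
    by move=> a b /piece_mono.
  move=> i.
  have [n [k [q [j [kP iE]]]]] : exists n k q j, is_key S n k q j /\
      piece (mk_key n k q j) = i.
    have [_ [q1 Sq1] [q0 Sq0]] := S_cut (i %/ 3).
    have im : (i < (m * 3).+1)%N by [].
    have [i3 iE] : (i %% 3 < 3)%N /\ (i = i %/ 3 * 3 + i %% 3 :> nat)%N.
      by rewrite ltn_mod -divn_eq.
    (* The rational is taken inside the cut only for part 1; i = 3m yields a point of block m, in
       the tail piece. *)
    exists (i %/ 3), (i %% 3), (if i %% 3 == 1 then q1 else q0)%N, 0%N; split.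
      by rewrite /is_key /=; case: (i %% 3)%N => [|[|]] //=; rewrite ?Sq0 ?Sq1.
    by rewrite /piece /=; case: ifP; lia.
  by have [a aE] := is_keyP kP; exists a; apply/val_inj; rewrite /= aE.
- split=> [a b fab|a b c].
    by apply: (@point_key_inj S); apply: le_anti; rewrite -!f_le fab lexx.
  by rewrite /cut_order /circ !f_le.
- move=> i; apply: interval_co_convex; first exact: point_key_inj.
  move=> _ _ w [a /= pa <-] [b /= pb <-].
  rewrite !fE => /andP[aw wb].
  have := congr1 val (etrans pa (esym pb)); have := congr1 val pa => /=.
  have [na [ka [qa [ja [/and3P[_ a0 a1] aE]]]]] := point_keyP S a.
  have [nb [kb [qb [jb [/and3P[_ b0 b1] bE]]]]] := point_keyP S b.
  have [n [k [q [j [/and3P[jS w0 w1] wE]]]]] := point_keyP T w.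
  move: aw wb; rewrite aE bE wE => /key_leW[an aw] /key_leW[nb' wb] /= ia ab.
  suff wP : exists c, piece (point_key S c) = i /\
      shift (point_key S c) = point_key T w.
    have [c [pc fc]] := wP; exists c; first exact/val_inj.
    by apply: (@point_key_inj T); rewrite fE.
  rewrite wE /=; move: ia ab; case: (ltnP na m) => nam ia ab; last first.
    have nm : (m <= n)%N by exact: leq_trans an.
    have [|c cE] := @is_keyP S n k q j.
      by rewrite /is_key jS eq_tail // w0 w1.
    by exists c; rewrite cE /piece /shift /= ltnNge nm.
  have nbm : (nb < m)%N by move: ab; case: ltnP => //; lia.
  rewrite nbm in ab wb *.
  have [ena enb] : na = n /\ n = nb by lia.
  move: aw wb; rewrite nam ena -enb => /(_ erefl)[kak aw] /(_ erefl)[kkb wb].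
  rewrite ena -enb in ab ia a0 a1 b0 b1 nam.
  have [down _ _] := S_cut n.
  (* Undoing the shift sends w to part k - 2. If that is part 0, then a is in part 0 and q is at or
     above its rational, so outside the cut; if it is part 1, then b is in part 1 and q is at or
     below its rational, so inside. *)
  have [|c cE] := @is_keyP S n k.-2 q j; last first.
    exists c; rewrite cE /piece /shift /= nam; split; first lia.
    by case: k kak {aw wb w0 w1 kkb wE cE} => [|[|k]].
  rewrite /is_key jS /=; apply/andP; split; apply/implyP => /eqP k0.
    have [ka0 kk] : ka = 0%N /\ ka.+2 = k by lia.
    move: a0; rewrite ka0 /=; apply: contra; apply: down.
    exact: aw.
  have [kb1 kk] : kb = 1%N /\ k = kb.+2 by lia.
  by move: b1; rewrite kb1 /=; apply: down; exact: wb.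
Qed.
End EventuallyEqual.

(** * Recovering the tail of a sequence *)

Definition block (a : nat) : nat := (raw_point a).1.

Section Blocks.
Variable S : nat -> rat -> bool.

Lemma block_key (a n k : nat) (q : rat) (j : nat) :
  point_key S a = mk_key n k q j -> block a = n.
Proof.
by rewrite /point_key /block; case: (raw_point a) => [n' [t [q' j']]] [].
Qed.

Lemma block_exists (n : nat) : exists a, block a = n.
Proof.
have [i _ iE] : range raw_point (n, (0, (0%R, 0)))%N.
  by rewrite range_raw_point.
by exists i; rewrite /block iE.
Qed.

Lemma block_lt (a b : nat) :
  (block a < block b)%N -> (point_key S a < point_key S b)%O.
Proof.
have [n [k [q [j [_ aE]]]]] := point_keyP S a.
have [n' [k' [q' [j' [_ bE]]]]] := point_keyP S b.
by rewrite (block_key aE) (block_key bE) aE bE key_ltE => ->.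
Qed.

Lemma le_block (a b : nat) :
  (point_key S a <= point_key S b)%O -> (block a <= block b)%N.
Proof. by rewrite leNgt leqNgt; apply: contra; exact: block_lt. Qed.

(** Some piece meets infinitely many of the representatives [h u]. If it contains the arc from some
    [h v] round to an earlier [h u], it contains all blocks after v; otherwise convexity always
    yields the forward arcs, and these exhaust the tail. *)
Lemma tail_in_piece (n : nat) (P : 'I_n -> set nat) :
  finite_convex_partition (cut_order S) P ->
  exists i M, forall a, (M <= block a)%N -> P i a.
Proof.
move=> [_ _ P_cover P_convex _]; have [h hE] := choice block_exists.
have [i P_inf] : exists i, forall N, exists2 u, (N <= u)%N & P i (h u).
  apply: contrapT => no_i.
  have /choice[N NP] i : exists N, forall u, (N <= u)%N -> ~ P i (h u).
    apply: contrapT => no_N; apply: no_i; exists i => N.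
    apply: contrapT => no_u; apply: no_N; exists N => u Nu Pu.
    by apply: no_u; exists u.
  have [i _ Pi] : (\bigcup_i P i) (h (\max_i N i)%N) by rewrite P_cover.
  by apply: NP Pi; exact: leq_bigmax.
exists i.
have [[u [v [uv Pv]]]|no_uv] := EM (exists u v, (u < v)%N /\
    forall c, cut_order S (h v) c (h u) -> P i c).
  exists v.+1 => a va; apply: Pv; apply/or3P; apply: Or33.
  by rewrite !ltW // block_lt // !hE.
have [u _ Pu] := P_inf 0%N; exists u.+1 => a ua.
have [v av Pv] := P_inf (block a).+1.
have uv : (u < v)%N by exact: ltn_trans av.
have [|itv|itv] := P_convex i _ _ Pu Pv.
- by move=> huv; move: uv; rewrite -(hE u) -(hE v) huv ltnn.
- by apply: itv; apply: between_circ; rewrite !ltW // block_lt // !hE.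
- by case: no_uv; exists u, v.
Qed.

Lemma circ_adjacent (u v w : nat) (n k : nat) (q : rat) (j : nat) :
  point_key S u = mk_key n k q j -> point_key S v = mk_key n k q j.+1 ->
  cut_order S u w v -> w = u \/ w = v.
Proof.
move=> uE vE uwv; apply: (point_key_succ uE vE); apply: circ_between uwv.
by rewrite uE vE key_ltE !eqxx ltnSn !orbT.
Qed.

(** Nothing lies strictly between u and v, so an arc reaching v from elsewhere passes through u. *)
Lemma circ_pred (u v w : nat) (n k : nat) (q : rat) (j : nat) :
  point_key S u = mk_key n k q j -> point_key S v = mk_key n k q j.+1 ->
  w <> v -> cut_order S w u v.
Proof.
move=> uE vE wv; rewrite /cut_order /circ.
have -> : (point_key S u <= point_key S v)%O.
  by rewrite ltW // uE vE key_ltE !eqxx ltnSn !orbT.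
have [//|uw /=] := leP (point_key S w) (point_key S u).
rewrite leNgt; apply/orP; left; apply/negP => wv'.
have [wu|//] : w = u \/ w = v by apply: (point_key_succ uE vE); rewrite !ltW.
by rewrite wu ltxx in uw.
Qed.

Lemma circ_succ (u v w : nat) (n k : nat) (q : rat) (j : nat) :
  point_key S u = mk_key n k q j -> point_key S v = mk_key n k q j.+1 ->
  w <> u -> cut_order S u v w.
Proof.
move=> uE vE wu; rewrite /cut_order /circ.
have -> : (point_key S u <= point_key S v)%O.
  by rewrite ltW // uE vE key_ltE !eqxx ltnSn !orbT.
have [//|wv /=] := leP (point_key S v) (point_key S w).
rewrite !andbT leNgt; apply/negP => uw.
have [//|wv'] : w = u \/ w = v by apply: (point_key_succ uE vE); rewrite !ltW.
by rewrite wv' ltxx in wv.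
Qed.

Hypothesis S_cut : forall n, is_cut (S n).

Lemma adjacent_key (u v : nat) (n k : nat) (q : rat) (j : nat) :
  u <> v -> (forall w, cut_order S u w v -> w = u \/ w = v) ->
  point_key S u = mk_key n k q j -> point_key S v = mk_key n k q j.+1.
Proof.
move=> uv adj uE.
have [lt_uv|lt_vu|/point_key_inj//] := ltgtP (point_key S u) (point_key S v).
  have [//|[w /andP[uw wv]]] := point_key_dense S_cut lt_uv uE.
  have [wE|wE] : w = u \/ w = v by apply/adj/between_circ; rewrite !ltW.
  - by rewrite wE ltxx in uw.
  - by rewrite wE ltxx in wv.
(* If v precedes u, the arc from u to v wraps around and contains all blocks after that of u. *)
have [w wE] := block_exists (block u).+1.
have uw : (point_key S u < point_key S w)%O by rewrite block_lt // wE.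
have [wE'|wE'] : w = u \/ w = v.
- by apply: adj; apply/or3P; apply: Or33; rewrite !ltW.
- by rewrite wE' ltxx in uw.
- by have := lt_trans lt_vu uw; rewrite wE' ltxx.
Qed.

End Blocks.

Section Embedding.
Variables (S T : nat -> rat -> bool) (f : nat -> nat).
Hypotheses (S_cut : forall n, is_cut (S n)) (T_cut : forall n, is_cut (T n)).
Hypothesis f_emb : co_embedding (cut_order S) (cut_order T) f.

Let f_inj : injective f. Proof. exact: f_emb.1. Qed.

Let f_circ a b c : cut_order S a b c -> cut_order T (f a) (f b) (f c).
Proof. exact: f_emb.2. Qed.

(** Otherwise totality gives the opposite orientation, the images satisfy both, and two of the
    points coincide. *)
Lemma embedding_reflects (a b c : nat) :
  cut_order T (f a) (f b) (f c) -> cut_order S a b c.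
Proof.
have S_co : circular_order (cut_order S).
  exact: circ_circular_order (@point_key_inj S).
have T_co : circular_order (cut_order T).
  exact: circ_circular_order (@point_key_inj T).
move=> Tabc; have [//|Sbac] := co_total S_co a b c.
have := conj Tabc (f_circ Sbac) => /(co_antisym_refl T_co) eq_f.
suff [//] : cut_order S a b c /\ cut_order S b a c.
apply/(co_antisym_refl S_co); case: eq_f => /f_inj.
- exact: Or31.
- exact: Or32.
- exact: Or33.
Qed.

Definition tail_convex (M : nat) : Prop := forall a b, (M <= block a)%N ->
  (point_key S a < point_key S b)%O ->
  forall d, cut_order T (f a) d (f b) ->
  exists2 c, (point_key S a <= point_key S c <= point_key S b)%O & f c = d.

(* If the image of the tail misses a point between f a and f b, it cannot
   miss any other arc, so the image is convex beyond b. *)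
Lemma tail_convex_exists (A : set nat) (N : nat) :
  (forall a, (N <= block a)%N -> A a) -> co_convex (cut_order T) (f @` A) ->
  exists M, tail_convex M.
Proof.
move=> NA A_convex.
(* Once d has a preimage, [embedding_reflects] places that preimage between a and b. *)
suff [M MP] : exists M, forall a b, (M <= block a)%N ->
    (point_key S a < point_key S b)%O ->
    forall d, cut_order T (f a) d (f b) -> (f @` A) d.
  exists M => a b Ma ab d adb; have [c _ cd] := MP a b Ma ab d adb.
  exists c => //; apply: (circ_between ab); apply: embedding_reflects.
  by rewrite cd.
have [all_ok|] := EM (forall a b, (N <= block a)%N ->
    (point_key S a < point_key S b)%O ->
    forall d, cut_order T (f a) d (f b) -> (f @` A) d).
  by exists N.
move=> /existsNP[a /existsNP[b /not_implyP[Na /not_implyP[ab]]]].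
move=> /existsNP[d /not_implyP[adb dA]].
exists (block b).+1 => a' b' ba' ab' e a'eb'.
have lt_ba' : (point_key S b < point_key S a')%O by exact: block_lt.
have Nb : (N <= block b)%N by apply: leq_trans (le_block (ltW ab)).
have Na' : (N <= block a')%N by apply: leq_trans ba'; exact: leqW.
have Aa' : A a' by exact: NA.
have Ab' : A b' by apply: NA; exact: leq_trans (le_block (ltW ab')).
have Aa : A a by exact: NA.
have Ab : A b by exact: NA.
have [|itv|itv] := A_convex (f a') (f b') (imageP f Aa') (imageP f Ab').
- by move=> /f_inj eab; rewrite eab ltxx in ab'.
- exact: itv.
(* The arc from [f b'] round to [f a'] contains the arc from [f a] to [f b], hence the missed point
   d. *)
exfalso; apply: (dA); apply: itv.
have neq c : A c -> d <> f c by move=> Ac dE; apply: dA; exists c.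
have neq_a c : (point_key S a < point_key S c)%O ->
    point_key T (f a) <> point_key T (f c).
  by move=> ac /point_key_inj/f_inj eac; rewrite eac ltxx in ac.
have lt_aa' := lt_trans ab lt_ba'; have lt_ab' := lt_trans lt_aa' ab'.
rewrite /cut_order; apply: (@circ_arc _ _ (point_key T (f a)) (point_key T (f b))
  (point_key T (f a')) (point_key T (f b')) (point_key T d)).
- by apply/f_circ/between_circ; rewrite !ltW.
- by apply/f_circ/between_circ; rewrite !ltW // (lt_trans lt_ba').
- by apply/f_circ/between_circ; rewrite !ltW.
- exact: adb.
- exact: neq_a.
- exact: neq_a.
- exact: neq_a.
- by move=> /point_key_inj; exact: neq.
- by move=> /point_key_inj; exact: neq.
Qed.

Variable M : nat.
Hypothesis f_tail : tail_convex M.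

(** A point on the arc between the images would have a preimage between a and b, which are
    consecutive. *)
Lemma embedding_succ (a b n k j n' k' j' : nat) (q q' : rat) :
  (M <= block a)%N ->
  point_key S a = mk_key n k q j -> point_key S b = mk_key n k q j.+1 ->
  point_key T (f a) = mk_key n' k' q' j' ->
  point_key T (f b) = mk_key n' k' q' j'.+1.
Proof.
move=> Ma aE bE faE.
have ab : (point_key S a < point_key S b)%O.
  by rewrite aE bE key_ltE !eqxx ltnSn !orbT.
apply: (adjacent_key T_cut) faE => [/f_inj eab|d adb].
  by rewrite eab ltxx in ab.
have [c /(point_key_succ aE bE) cab <-] := f_tail Ma ab adb.
by case: cab => ->; [left|right].
Qed.

(** A predecessor u of [f a] in its chunk would be [f c] for some c < a. As a starts its chunk, some
    e lies strictly between c and a, and [f e] would lie strictly between u and [f a]. The strict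
    bound on M leaves room for a tail point p before a. *)
Lemma embedding_first (a n k n' k' j' : nat) (q q' : rat) :
  (M < block a)%N -> point_key S a = mk_key n k q 0 ->
  point_key T (f a) = mk_key n' k' q' j' -> j' = 0%N.
Proof.
move=> Ma aE; case: j' => [//|j'] faE.
have [u uE] : exists u, point_key T u = mk_key n' k' q' j'.
  apply: is_keyP; have [? [? [? [? [+ faE']]]]] := point_keyP T (f a).
  move: faE'; rewrite faE => -[<- <- <- <-] /and3P[jT k0 k1].
  by rewrite /is_key k0 k1 ltnW.
have ua : u <> f a by move=> eu; move: uE; rewrite eu faE => -[]; lia.
have [p pE] := block_exists M.
have pa : (point_key S p < point_key S a)%O by rewrite block_lt // pE.
have fpa : f p <> f a by move=> /f_inj epa; rewrite epa ltxx in pa.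
have Mp : (M <= block p)%N by rewrite pE.
have [c /andP[pc ca] fcu] := f_tail Mp pa (circ_pred uE faE fpa).
have lt_ca : (point_key S c < point_key S a)%O.
  rewrite lt_neqAle ca andbT; apply/eqP => /point_key_inj eca.
  by apply: ua; rewrite -fcu eca.
have [n1 [k1 [q1 [j1 [_ cE]]]]] := point_keyP S c.
have [|[e /andP[ce ea]]] := point_key_dense S_cut lt_ca cE.
  by rewrite aE.
have [] : f e = u \/ f e = f a.
- apply: (circ_adjacent uE faE); rewrite -fcu.
  by apply/f_circ/between_circ; rewrite !ltW.
- by rewrite -fcu => /f_inj eec; rewrite eec ltxx in ce.
- by move=> /f_inj eea; rewrite eea ltxx in ea.
Qed.

(** Mirror image of [embedding_first], with p taken in the next block. *)
Lemma embedding_last (a n k j n' k' j' : nat) (q q' : rat) :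
  (M <= block a)%N ->
  point_key S a = mk_key n k q j -> j.+1 = chunk_size n q ->
  point_key T (f a) = mk_key n' k' q' j' -> j'.+1 = chunk_size n' q'.
Proof.
move=> Ma aE jS faE.
have [? [? [? [? [+ faE']]]]] := point_keyP T (f a).
move: faE'; rewrite faE => -[<- <- <- <-] /and3P[jT k0 k1].
apply/eqP; rewrite eqn_leq jT leqNgt; apply/negP => j'T.
have [u uE] : exists u, point_key T u = mk_key n' k' q' j'.+1.
  by apply: is_keyP; rewrite /is_key k0 k1 j'T.
have ua : u <> f a by move=> eu; move: uE; rewrite eu faE => -[]; lia.
have [p pE] := block_exists (block a).+1.
have ap : (point_key S a < point_key S p)%O by rewrite block_lt // pE.
have fpa : f p <> f a by move=> /f_inj epa; rewrite epa ltxx in ap.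
have [c /andP[ac cp] fcu] := f_tail Ma ap (circ_succ faE uE fpa).
have lt_ac : (point_key S a < point_key S c)%O.
  rewrite lt_neqAle ac andbT; apply/eqP => /point_key_inj eca.
  by apply: ua; rewrite -fcu eca.
have [cE|[e /andP[ae ec]]] := point_key_dense S_cut lt_ac aE.
  have [? [? [? [? [+ cE']]]]] := point_keyP S c.
  by move: cE'; rewrite cE => -[<- <- <- <-] /and3P[]; rewrite jS ltnn.
have [] : f e = f a \/ f e = u.
- apply: (circ_adjacent faE uE); rewrite -fcu.
  by apply/f_circ/between_circ; rewrite !ltW.
- by move=> /f_inj eea; rewrite eea ltxx in ae.
- by rewrite -fcu => /f_inj eec; rewrite eec ltxx in ec.
Qed.

(** First points, successors and last points are preserved, so the chunk maps onto a chunk of the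
    same size, and the size determines (n, q). Only the part may change. *)
Lemma embedding_label (a n k j : nat) (q : rat) :
  (M < block a)%N -> point_key S a = mk_key n k q j ->
  exists k', point_key T (f a) = mk_key n k' q j.
Proof.
move=> Ma aE.
have [? [? [? [? [+ aE']]]]] := point_keyP S a.
move: aE'; rewrite aE => -[<- <- <- <-] /and3P[jS k0 k1].
have key_i i : (i < chunk_size n q)%N -> is_key S n k q i.
  by move=> iS; rewrite /is_key iS k0 k1.
have [a0 a0E] := is_keyP (key_i 0%N isT).
have Ma0 : (M < block a0)%N by rewrite (block_key a0E) -(block_key aE).
have [n' [k' [q' [j' [_ fa0E]]]]] := point_keyP T (f a0).
have j'0 := embedding_first Ma0 a0E fa0E; rewrite {}j'0 {j'} in fa0E.
have chain i b : (i < chunk_size n q)%N -> point_key S b = mk_key n k q i ->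
    point_key T (f b) = mk_key n' k' q' i.
  elim: i b => [|i IH] b iS bE.
    by rewrite -fa0E; congr (point_key T (f _)); apply: (@point_key_inj S);
       rewrite bE.
  have [c cE] := is_keyP (key_i i (ltnW iS)).
  apply: (embedding_succ _ cE bE (IH c (ltnW iS) cE)).
  by rewrite (block_key cE) -(block_key aE) ltnW.
have [b bE] := is_keyP (key_i (chunk_size n q).-1 (ltnSn _)).
have Mb : (M <= block b)%N by rewrite (block_key bE) -(block_key aE) ltnW.
have [en eq] := chunk_size_inj
  (embedding_last Mb bE erefl (chain _ b (ltnSn _) bE)).
by exists k'; rewrite en eq; exact: chain.
Qed.

Lemma embedding_cut_le (n : nat) (q : rat) : (M.+1 < n)%N -> T n q -> S n q.
Proof.
move=> Mn Tq; apply/negP => /negP Sq.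
have [S_down [q' Sq'] _] := S_cut n; have [T_down _ _] := T_cut n.
have lt_q'q : (q' < q)%R.
  by rewrite ltNge; apply/negP => qq'; move: Sq; rewrite (S_down _ _ qq').
have [a aE] : exists a, point_key S a = mk_key n 0 q 0.
  by apply: is_keyP; rewrite /is_key Sq.
have Ma : (M < block a)%N by rewrite (block_key aE) ltnW.
have [k faE] := embedding_label Ma aE.
(* Since q is in the cut [T n], [f a] is not in part 0, so this point of part 1 with a smaller
   rational precedes it. *)
have [b bE] : exists b, point_key T b = mk_key n 1 q' 0.
  by apply: is_keyP; rewrite /is_key (T_down _ _ (ltW lt_q'q)).
have k_gt0 : (0 < k)%N.
  have [? [? [? [? [+ faE']]]]] := point_keyP T (f a).
  move: faE'; rewrite faE => -[<- <- <- <-] /and3P[_ + _].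
  by rewrite Tq; case: (k).
have b_fa : (point_key T b < point_key T (f a))%O.
  by rewrite bE faE key_ltE eqxx lt_q'q ltnn /=; case: (ltngtP 1%N k) k_gt0.
(* Block n - 1 is still beyond M, so [f p] stays in block n - 1 and b lies between [f p] and
   [f a]. *)
have [p pE] := block_exists n.-1.
have Mp : (M < block p)%N by rewrite pE; lia.
have pa : (point_key S p < point_key S a)%O.
  by rewrite block_lt // pE (block_key aE); lia.
have [np [kp [qp [jp [_ pkE]]]]] := point_keyP S p.
have [kp' fpE] := embedding_label Mp pkE.
have fp_b : (point_key T (f p) < point_key T b)%O.
  by rewrite block_lt // (block_key fpE) (block_key bE) -(block_key pkE) pE; lia.
have [|c /andP[pc ca] fcb] := @f_tail p a (ltnW Mp) pa b.
  by apply: between_circ; rewrite !ltW.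
have [nc [kc [qc [jc [ckey cE]]]]] := point_keyP S c.
have [|kc' fcE] := @embedding_label c _ _ _ _ _ cE.
  exact: leq_trans (le_block pc).
(* The preimage c of b has label (n, q') and is at most a, so it is in part 0; but q' is inside the
   cut [S n]. *)
move: fcE ckey cE; rewrite fcb bE => -[<- _ <- <-] /and3P[_ c0 _] cE.
move: ca; rewrite cE aE => /key_leW[_ /(_ erefl)[]].
by case: kc {cE} c0 => //=; rewrite Sq'.
Qed.

End Embedding.

Lemma embeddable_cut_le (S T : nat -> rat -> bool) :
  (forall n, is_cut (S n)) -> (forall n, is_cut (T n)) ->
  piecewise_convex_embeddable (cut_order S) (cut_order T) ->
  exists m, forall n q, (m <= n)%N -> T n q -> S n q.
Proof.
move=> S_cut T_cut [r [P [f [P_part f_emb f_convex]]]].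
have [i [N NP]] := tail_in_piece P_part.
have [M MP] := tail_convex_exists f_emb NP (f_convex i).
by exists M.+2 => n q; exact: (embedding_cut_le S_cut T_cut f_emb MP).
Qed.


(** * Borel measurability of the coding *)

Section Borel.
Local Open Scope ring_scope.

Lemma borelC (T : topologicalType) (A : set T) : borel A -> borel (~` A).
Proof.
by have [_ bD _] := smallest_sigma_algebra setT (@open T) => /bD; rewrite setTD.
Qed.

Lemma borel_bigcup (T : topologicalType) (I : countType) (F : I -> set T) :
  (forall i, borel (F i)) -> borel (\bigcup_i F i).
Proof.
move=> bF; have [b0 _ bU] := smallest_sigma_algebra setT (@open T).
have -> : \bigcup_i F i = \bigcup_n oapp F set0 (unpickle n).
  apply/seteqP; split=> [x [i _ Fx]|x [n _]].
    by exists (pickle i) => //; rewrite pickleK.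
  by case: (unpickle n) => [i Fx|//]; exists i.
by apply: bU => n; case: (unpickle n).
Qed.

Lemma borelI (T : topologicalType) (A B : set T) :
  borel A -> borel B -> borel (A `&` B).
Proof.
move=> bA bB.
have -> : A `&` B = ~` \bigcup_(b : bool) (if b then ~` A else ~` B).
  apply/seteqP; split=> [x [Ax Bx] [[] _ //]|x nABx].
  by split; apply: contrapT => nx; apply: nABx; [exists true|exists false].
by apply: borelC; apply: borel_bigcup => -[]; exact: borelC.
Qed.

Lemma borel_cst (T : topologicalType) (b : bool) : borel [set _ : T | b].
Proof.
apply: sub_sigma_algebra; case: b.
- by rewrite set_true; exact: openT.
- by rewrite set_false; exact: open0.
Qed.

Lemma borel_if (T : topologicalType) (h : T -> bool) (A B : T -> bool) :
  borel [set x | h x] -> borel [set x | A x] -> borel [set x | B x] ->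
  borel [set x | if h x then A x else B x].
Proof.
move=> bh bA bB.
have -> : [set x | if h x then A x else B x] =
    ~` (~` ([set x | h x] `&` [set x | A x]) `&`
        ~` (~` [set x | h x] `&` [set x | B x])).
  rewrite setCI !setCK; apply/seteqP; split=> x /=.
    by case: ifP => hx ?; [left|right].
  by case=> -[]; [move=> -> | move=> /negP/negbTE ->].
by apply: borelC; apply: borelI; apply: borelC; apply: borelI => //;
   exact: borelC.
Qed.

Lemma borel_function_open (T U : topologicalType) (f : T -> U) :
  (forall V : set U, open V -> borel (f @^-1` V)) -> borel_function f.
Proof.
move=> f_open B.
suff : @borel U `<=` image_set_system setT f (@borel T).
  by move=> /(_ B) h /h; rewrite /image_set_system /= setTI.
apply: smallest_sub.
  by apply: sigma_algebra_image; exact: smallest_sigma_algebra.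
by move=> V /f_open; rewrite /image_set_system /= setTI.
Qed.

(** Otherwise choose [e n] outside V agreeing with c on the indices decoded from numbers below n.
    Then [e] converges pointwise to c, so it eventually enters V. *)
Lemma ptws_open_cylinder (I : countType) (V : set {ptws I -> bool})
    (c : {ptws I -> bool}) : open V -> V c ->
  exists s : seq (I * bool), {in s, forall p, c p.1 = p.2} /\
    forall c' : {ptws I -> bool}, {in s, forall p, c' p.1 = p.2} -> V c'.
Proof.
move=> oV Vc.
pose s n := [seq (i, c i) | i <- pmap (@unpickle I) (iota 0 n)].
apply: contrapT => no_s.
have /choice[e eP] n : exists c' : {ptws I -> bool},
    {in s n, forall p, c' p.1 = p.2} /\ ~ V c'.
  apply: contrapT => no_c; apply: no_s; exists (s n); split.
    by move=> _ /mapP[i _ ->].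
  by move=> c' c'P; apply: contrapT => Vc'; apply: no_c; exists c'.
have e_cvg : (e : nat -> {ptws I -> bool}) @ \oo --> c.
  apply/cvg_sup => i A; rewrite nbhsE => -[B [oB Bc] BA].
  have [W opW WE] := oB; rewrite -{}WE in Bc BA.
  exists (pickle i).+1 => // n /= in_; apply: BA => /=.
  have /(_ (i, c i)) -> // := (eP n).1.
  apply: map_f; rewrite mem_pmap.
  by apply/mapP; exists (pickle i); rewrite ?pickleK // mem_iota.
have : \forall n \near \oo, V (e n) by apply: e_cvg; apply: open_nbhs_nbhs.
by case=> n _ /(_ n (leqnn _)); exact: (eP n).2.
Qed.

(** V is the union of the cylinders it contains, and there are only countably many cylinders. *)
Lemma borel_preimage_ptws (T : topologicalType) (I : countType)
    (c : T -> {ptws I -> bool}) (V : set {ptws I -> bool}) :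
  (forall i, borel [set x | c x i]) -> open V -> borel (c @^-1` V).
Proof.
move=> c_borel oV.
pose Z (s : seq (I * bool)) (e : {ptws I -> bool}) := all (fun p => e p.1 == p.2) s.
pose F s := [set x | `[< [set e | Z s e] `<=` V >] && Z s (c x)].
have -> : c @^-1` V = \bigcup_s F s.
  apply/seteqP; split=> [x Vx|x [s _ /andP[/asboolP ZV cx]]]; last exact: ZV.
  have [s [cs sV]] := ptws_open_cylinder oV Vx; exists s => //.
  apply/andP; split.
    by apply/asboolP => e /allP es; apply: sV => p /es/eqP.
  by apply/allP => p /cs ->.
apply: borel_bigcup => s; rewrite /F; case: `[< _ >] => /=; last exact: borel_cst.
elim: s => [|[i b] s IH] /=; first exact: borel_cst.
have -> : [set x | (c x i == b) && Z s (c x)] =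
    [set x | if c x i then b && Z s (c x) else ~~ b && Z s (c x)].
  by apply/funext => x /=; case: (c x i); case: b.
apply: borel_if => //; case: b => //=; exact: borel_cst.
Qed.

End Borel.

(** * The reduction map and its correctness *)

Section Reduction.
Variable R : realType.
Local Open Scope ring_scope.

Definition cuts (x : real_sequences R) (n : nat) (q : rat) : bool :=
  ratr q < x n.

Lemma is_cut_cuts (x : real_sequences R) (n : nat) : is_cut (cuts x n).
Proof.
split.
- by move=> p q pq; apply: le_lt_trans; rewrite ler_rat.
- have [q] := @rat_in_itvoo R (x n - 1) (x n) ltac:(by rewrite ltrBlDr ltrDl).
  by rewrite in_itv /= => /andP[_ qx]; exists q.
- have [q] := @rat_in_itvoo R (x n) (x n + 1) ltac:(by rewrite ltrDl).
  by rewrite in_itv /= => /andP[xq _]; exists q; rewrite /cuts -leNgt ltW.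
Qed.

Lemma cuts_eq (x y : real_sequences R) (n : nat) :
  cuts x n =1 cuts y n -> x n = y n.
Proof.
wlog xy : x y / x n < y n => [wlog_lt eq_cuts|eq_cuts].
  have [xy|yx|//] := ltgtP (x n) (y n); first exact: wlog_lt.
  by apply/esym/wlog_lt => // q; rewrite eq_cuts.
have [q] := rat_in_itvoo xy; rewrite in_itv /= => /andP[xq qy].
by have := eq_cuts q; rewrite /cuts qy ltNge (ltW xq).
Qed.

Lemma borel_cuts (n : nat) (q : rat) : borel [set x | cuts x n q].
Proof.
apply: sub_sigma_algebra.
have proj_cont : continuous (fun x : real_sequences R => x n : R).
  exact: (@proj_continuous nat (fun=> R) n).
by move/continuousP: proj_cont => /(_ [set r | ratr q < r]); apply; exact: open_gt.
Qed.

Definition code (x : real_sequences R) : {ptws nat * nat * nat -> bool} :=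
  fun p => circ (point_key (cuts x) p.1.1) (point_key (cuts x) p.1.2)
                (point_key (cuts x) p.2).

Lemma code_CO (x : real_sequences R) : code x \in CO.
Proof.
by apply/mem_set; exact: circ_circular_order (@point_key_inj (cuts x)).
Qed.

Definition coded_order (x : real_sequences R) : CO := exist _ (code x) (code_CO x).

(** Each key depends on x through a single bit [cuts x n q], so a coded triple is a Boolean function
    of three Borel conditions. *)
Lemma borel_code (p : nat * nat * nat) : borel [set x | code x p].
Proof.
have keyE a : exists n q (g : bool -> key),
    forall x, point_key (cuts x) a = g (cuts x n q).
  rewrite /point_key; case: (raw_point a) => [n [t [q j]]]; exists n, q.
  by exists (fun b => mk_key n (if t is t'.+1 then t.+1 else b) q j).
rewrite /code; case: p => [[a b] c] /=.
have [na [qa [ga aE]]] := keyE a; have [nb [qb [gb bE]]] := keyE b.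
have [nc [qc [gc cE]]] := keyE c.
have -> : [set x | circ (point_key (cuts x) a) (point_key (cuts x) b)
      (point_key (cuts x) c)] =
    [set x | if cuts x na qa then
      if cuts x nb qb then
        if cuts x nc qc then circ (ga true) (gb true) (gc true)
        else circ (ga true) (gb true) (gc false)
      else if cuts x nc qc then circ (ga true) (gb false) (gc true)
        else circ (ga true) (gb false) (gc false)
    else if cuts x nb qb then
        if cuts x nc qc then circ (ga false) (gb true) (gc true)
        else circ (ga false) (gb true) (gc false)
      else if cuts x nc qc then circ (ga false) (gb false) (gc true)
        else circ (ga false) (gb false) (gc false)].
  apply/funext => x /=; rewrite aE bE cE.
  by case: (cuts x na qa); case: (cuts x nb qb); case: (cuts x nc qc).
by do 3!(apply: borel_if; [exact: borel_cuts| |]); exact: borel_cst.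
Qed.

Lemma borel_coded_order : borel_function coded_order.
Proof.
apply: borel_function_open => V [W opW <-].
exact: (borel_preimage_ptws borel_code opW).
Qed.

End Reduction.

Theorem theorem3p45 (R : realType) :
  borel_reducible (@E1 R) CO_piecewise_biembeddable.
Proof.
exists (@coded_order R); first exact: borel_coded_order.
move=> x y; split=> [[m xy]|[xy yx]].
  have eq_cuts n : (m <= n)%N -> cuts x n =1 cuts y n.
    by move=> mn q; rewrite /cuts xy.
  split; apply: (eventually_eq_embeddable (m := m)) => [n|n mn q].
  - exact: is_cut_cuts.
  - exact: eq_cuts.
  - exact: is_cut_cuts.
  - by rewrite eq_cuts.
(* Each embedding yields one eventual inclusion of cuts; together they give equality of the
   reals. *)
have [m le_yx] := embeddable_cut_le (is_cut_cuts x) (is_cut_cuts y) xy.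
have [m' le_xy] := embeddable_cut_le (is_cut_cuts y) (is_cut_cuts x) yx.
exists (maxn m m') => n; rewrite geq_max => /andP[mn m'n].
by apply: cuts_eq => q; apply/idP/idP; [exact: le_xy|exact: le_yx].
Qed.
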